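(* Let $\mathcal{L}$ be a distributive abstract logic. For all $a,b\in Expr_{\mathcal{L}}$, $a\le b$ if and only if $a\Vdash_{\mathcal{L}} b$.
   Context: An abstract logic is a triple $\mathcal{L}=(Expr_{\mathcal{L}},Th_{\mathcal{L}},\mathcal{C}_{\mathcal{L}})$ where $Expr_{\mathcal{L}}$ is a set, $Th_{\mathcal{L}}$ a non-empty set of subsets of $Expr_{\mathcal{L}}$ (theories) closed under intersections of non-empty subfamilies, and $\mathcal{C}_{\mathcal{L}}$ a set of operations on $Expr_{\mathcal{L}}$. $\mathcal{L}$ is closed under union of chains if the union of every non-empty chain of theories is a theory. A theory $T$ is prime if $T=\bigcap\mathcal{T}$ with $\mathcal{T}\subseteq Th_{\mathcal{L}}$ non-empty finite implies $T\in\mathcal{T}$; totally prime if this holds for non-empty $\mathcal{T}$ of any size. $PTh_{\mathcal{L}}$, $TPTh_{\mathcal{L}}$ denote these sets. A distributive abstract logic is one closed under union of chains with binary connectives $\vee,\wedge$ such that for all $a,b$ and all $T\in TPTh_{\mathcal{L}}$: $a\vee b\in T$ iff $a\in T$ or $b\in T$; $a\wedge b\in T$ iff $a,b\in T$. $b\Vdash_{\mathcal{L}}a$ means $a$ belongs to every theory containing $b$. The order: $a\le b$ iff $S_a\subseteq S_b$, where $S_a=\{P\in PTh_{\mathcal{L}}: a\in P\}$. *)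

(* Defs.v *)
From Stdlib Require Import List Vectors.Fin.

Set Implicit Arguments.

(* Subsets of Expr are predicates
   Expr -> Prop; equality of subsets is Leibniz equality of predicates
   (extensional under the whitelisted funext/propext axioms). *)

Definition bigcap (E : Type) (F : (E -> Prop) -> Prop) : E -> Prop :=
  fun a => forall U, F U -> U a.

Definition bigcup (E : Type) (F : (E -> Prop) -> Prop) : E -> Prop :=
  fun a => exists U, F U /\ U a.

Record abstract_logic := AbstractLogic {
  Expr : Type;
  Th : (Expr -> Prop) -> Prop;
  Conn : forall n : nat, ((Fin.t n -> Expr) -> Expr) -> Prop;
  Th_nonempty : exists T, Th T;
  Th_inter : forall F : (Expr -> Prop) -> Prop,
      (exists T, F T) -> (forall T, F T -> Th T) -> Th (bigcap F)
}.

Section AL.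
Variable L : abstract_logic.

Definition subset_of (A B : Expr L -> Prop) : Prop := forall a, A a -> B a.

Definition finite_family (F : (Expr L -> Prop) -> Prop) : Prop :=
  exists l : list (Expr L -> Prop), forall U, F U <-> In U l.

Definition chain_of_theories (F : (Expr L -> Prop) -> Prop) : Prop :=
  (exists T, F T) /\ (forall T, F T -> Th L T) /\
  (forall T U, F T -> F U -> subset_of T U \/ subset_of U T).

Definition closed_under_union_of_chains : Prop :=
  forall F, chain_of_theories F -> Th L (bigcup F).

Definition prime_theory (T : Expr L -> Prop) : Prop :=
  Th L T /\
  forall F : (Expr L -> Prop) -> Prop,
    (forall U, F U -> Th L U) -> (exists U, F U) -> finite_family F ->
    T = bigcap F -> F T.

Definition totally_prime_theory (T : Expr L -> Prop) : Prop :=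
  Th L T /\
  forall F : (Expr L -> Prop) -> Prop,
    (forall U, F U -> Th L U) -> (exists U, F U) ->
    T = bigcap F -> F T.

Definition binop (f : Expr L -> Expr L -> Expr L) : (Fin.t 2 -> Expr L) -> Expr L :=
  fun v => f (v Fin.F1) (v (Fin.FS Fin.F1)).

Definition distributive_logic : Prop :=
  closed_under_union_of_chains /\
  exists (vee wedge : Expr L -> Expr L -> Expr L),
    @Conn L 2 (binop vee) /\ @Conn L 2 (binop wedge) /\
    forall a b T, totally_prime_theory T ->
      (T (vee a b) <-> T a \/ T b) /\ (T (wedge a b) <-> T a /\ T b).

Definition entails (b a : Expr L) : Prop :=
  forall T, Th L T -> T b -> T a.

Definition S_ (a : Expr L) : (Expr L -> Prop) -> Prop :=
  fun P => prime_theory P /\ P a.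

Definition le_expr (a b : Expr L) : Prop := forall P, S_ a P -> S_ b P.

End AL.

(* Main.v *)
Require Import Defs.
From mathcomp Require Import all_boot.
From mathcomp Require Import boolp classical_sets.

(* A theory maximal among those omitting [b] is totally prime: if it were the
   intersection of a family not containing it, every member would strictly
   extend it and so contain [b], putting [b] in the intersection.  Such maximal
   theories exist above any theory omitting [b] by Zorn's lemma, since unions of
   chains of theories are theories. *)

Local Open Scope classical_set_scope.

Lemma ex_maximal_above (T : Type) (P : set (set T)) (A0 : set T) :
  P A0 ->
  (forall F, F !=set0 -> F `<=` P -> total_on F subset ->
     P (\bigcup_(X in F) X)) ->
  exists M, [/\ P M, A0 `<=` M & forall B, P B -> M `<=` B -> B = M].
Proof.
move=> PA0 chainP.
(* Zorn_bigcup also demands the empty chain; adjoining [A0] to every set avoids it. *)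
have [F FP totF|A [PA0A maxA]] := @Zorn_bigcup T [set X | P (X `|` A0)].
  have [->|/set0P F0] := eqVneq F set0.
    by rewrite /= bigcup_set0 set0U.
  rewrite /= -bigcupUl // -(bigcup_image F (setU^~ A0) id).
  apply: chainP => [|_ [X FX <-]|_ _ [X FX <-] [Y FY <-]].
  - by have [X FX] := F0; exists (X `|` A0), X.
  - exact: FP.
  - by have [XY|YX] := totF X Y FX FY; [left|right]; apply: setSU.
exists (A `|` A0); split=> [//||B PB AB]; first exact: subsetUr.
apply/seteqP; split=> //; apply/not_notP => BA.
have BA0 : B `|` A0 = B by apply/setUidPl/(subset_trans _ AB)/subsetUr.
apply: (maxA B); last by rewrite /= BA0.
split=> [|BA']; first exact: subset_trans (@subsetUl _ A A0) AB.
exact/BA/(subset_trans BA')/subsetUl.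
Qed.

Lemma Defs_bigcupE (E : Type) (F : set (set E)) :
  Defs.bigcup F = \bigcup_(X in F) X.
Proof. by apply/funext => a; apply/propext; split=> [[U []]|[U]]; exists U. Qed.

Section MaximalTheories.
Variable L : abstract_logic.

Definition maximal_omitting (b : Expr L) (M : set (Expr L)) :=
  [/\ Th L M, ~ M b & forall U, Th L U -> M `<=` U -> ~ U b -> U = M].

Lemma maximal_omitting_totally_prime {b : Expr L} {M : set (Expr L)} :
  maximal_omitting b M -> totally_prime_theory L M.
Proof.
case=> ThM Mb maxM; split=> // F ThF _ MF.
apply/not_notP => FM; apply: Mb; rewrite MF => U FU.
apply/not_notP => Ub; apply: FM.
suff <- : U = M by [].
by apply: maxM => //; [exact: ThF | rewrite MF => a; apply].
Qed.

Lemma totally_prime_theory_prime T : totally_prime_theory L T -> prime_theory L T.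
Proof. by case=> ThT primeT; split=> // F ThF F0 _; exact: primeT. Qed.

Hypothesis chainsL : closed_under_union_of_chains L.

Lemma ex_maximal_omitting {T : set (Expr L)} {b : Expr L} :
  Th L T -> ~ T b -> exists2 M, T `<=` M & maximal_omitting b M.
Proof.
move=> ThT Tb.
have [|F [X FX] FP totF|M [[ThM TM Mb] _ maxM]] :=
  @ex_maximal_above _ [set X | [/\ Th L X, T `<=` X & ~ X b]] T.
- by split.
- have chainF : chain_of_theories L F by split; [exists X | split=> // Y /FP[]].
  rewrite -Defs_bigcupE; split; first exact: chainsL chainF.
    have [_ TX _] := FP X FX.
    by rewrite Defs_bigcupE => a /TX Xa; exists X.
  by rewrite Defs_bigcupE => -[Y /FP[]].
- exists M => //; split=> // U ThU MU Ub.
  by apply: maxM => //; split=> //; exact: subset_trans MU.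
Qed.

Lemma le_expr_entails a b : le_expr L a b -> entails L a b.
Proof.
move=> leab T ThT Ta; apply/not_notP => Tb.
have [M TM maxM] := ex_maximal_omitting ThT Tb.
have [_ Mb _] := maxM.
apply: Mb; apply: (leab M _).2; split; last exact: TM.
exact/totally_prime_theory_prime/(maximal_omitting_totally_prime maxM).
Qed.

End MaximalTheories.

Lemma entails_le_expr (L : abstract_logic) (a b : Expr L) :
  entails L a b -> le_expr L a b.
Proof. by move=> ab P [[ThP primeP] Pa]; split; [split | exact: ab]. Qed.

Theorem corollary3p11 (L : abstract_logic) (HL : distributive_logic L) :
  forall a b : Expr L, @le_expr L a b <-> @entails L a b.
Proof.
have [chainsL _] := HL.
by move=> a b; split; [exact: le_expr_entails | exact: entails_le_expr].
Qed.
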